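(* Let $n\ge 1$ be an integer. The system \[ \{1\}\cup\{\sqrt2\cos(2\pi\,\mathbf k\cdot x):\mathbf k\in\mathbb Z^n,\ \mathbf k \succ 0\}\cup\{\sqrt2\sin(2\pi\,\mathbf k\cdot x):\mathbf k\in\mathbb Z^n,\ \mathbf k\succ 0\} \] is an orthonormal basis of the real Hilbert space $L_2((0,1)^n)$.
   Context: For $\mathbf k\in\mathbb Z^n\setminus\{0\}$ we write $\mathbf k\succ 0$ if the first non-zero entry of $\mathbf k$ is positive. Here $\mathbf k\cdot x=k_1x_1+\dots+k_nx_n$ is the standard scalar product on $\mathbb R^n$. *)

(* Defs.v *)
From HB Require Import structures.
From mathcomp Require Import all_boot all_order all_algebra.
From mathcomp Require Import sesquilinear.
From mathcomp Require Import all_classical all_reals all_analysis.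
From mathcomp Require Import measurable_realfun.

Set Implicit Arguments.
Unset Strict Implicit.
Unset Printing Implicit Defensive.

Import Order.TTheory GRing.Theory Num.Theory.
Import numFieldNormedType.Exports.

Local Open Scope classical_set_scope.
Local Open Scope ring_scope.

Section lebesgue_tuple.
Context {R : realType}.
Notation Rn n := (n.-tuple (measurableTypeR R)).

Definition tuple_cons n (p : measurableTypeR R * Rn n) : Rn n.+1 :=
  [tuple of p.1 :: p.2].

Lemma measurable_tuple_cons n : measurable_fun setT (@tuple_cons n).
Proof. exact: measurable_cons. Qed.

Section lebesgue_cons.
Variables (n : nat) (m : {sigma_finite_measure set (Rn n) -> \bar R}).

Definition lebesgue_cons : set (Rn n.+1) -> \bar R :=
  pushforward (@lebesgue_measure R \x m)%E (@tuple_cons n).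

Let mpush : {measure set (Rn n.+1) -> \bar R} :=
  measure_function_pushforward__canonical__measure_function_Measure
    [the {measure set _ -> \bar R} of (@lebesgue_measure R \x m)%E]
    (@measurable_tuple_cons n).

HB.instance Definition _ := Measure.copy lebesgue_cons mpush.

Let lebesgue_cons_sigma_finite : sigma_finite setT lebesgue_cons.
Proof.
have /sigma_finiteP[F [TF ndF Foo]] := sigma_finiteT (@lebesgue_measure R).
have /sigma_finiteP[G [TG ndG Goo]] := sigma_finiteT m.
pose g (x : Rn n.+1) : measurableTypeR R * Rn n :=
  (thead x, [tuple of behead x]).
have mg : measurable_fun setT g.
  apply/measurable_fun_pair; last exact: measurable_behead.
  exact: (measurable_tnth ord0).
exists (fun k => g @^-1` (F k `*` G k)).
  rewrite -preimage_bigcup; apply/esym; rewrite -subTset => x _.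
  have : (\bigcup_k F k) (g x).1 by rewrite -TF.
  have : (\bigcup_k G k) (g x).2 by rewrite -TG.
  move=> -[k _ Gx] -[l _ Fx]; exists (maxn k l) => //; split.
    by have /subsetPset := ndF _ _ (leq_maxr k l); exact.
  by have /subsetPset := ndG _ _ (leq_maxl k l); exact.
move=> k; have [mF Fk] := Foo k; have [mG Gk] := Goo k; split.
  by rewrite -[X in measurable X]setTI; apply: mg => //; exact: measurableX.
rewrite /lebesgue_cons /pushforward (_ : _ @^-1` _ = F k `*` G k).
  by rewrite product_measure1E// lte_mul_pinfty// ge0_fin_numE.
have gK p : g (tuple_cons p) = p.
  by case: p => x t; rewrite /g /tuple_cons/= theadE; congr pair; exact/val_inj.
by apply/funext => p; rewrite /preimage /= -[in RHS](gK p).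
Qed.

HB.instance Definition _ := Measure_isSigmaFinite.Build _ _ _ lebesgue_cons
  lebesgue_cons_sigma_finite.
End lebesgue_cons.

(* Lebesgue measure on R^n, as the n-fold product of the one on R; see
   lebesgue_tuple_box for its value on boxes. *)
Fixpoint lebesgue_tuple n : {sigma_finite_measure set (Rn n) -> \bar R} :=
  if n is n'.+1 then lebesgue_cons (lebesgue_tuple n')
  else \d_([tuple] : Rn 0).

End lebesgue_tuple.

Section L2.
Context d (T : measurableType d) (R : realType).
Variable mu : {measure set T -> \bar R}.

(* L2fun mu is the space of square-integrable functions, L2 mu its quotient by
   almost-everywhere equality, which the library provides as a bare type. *)
Definition L2fun := LfunType mu (lee1n 2).
Definition L2 : Type := LspaceType2 mu.

Implicit Types (f g : L2fun) (u v w : L2).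

Definition L2_fun u : T -> R := (u : LspaceType mu (lee1n 2)).

Lemma L2_fun_Lfun u : L2_fun u \in Lfun mu 2%:E.
Proof.
rewrite inE; apply/andP; split; rewrite inE /=.
  exact: (@measurable_funPT _ _ T (measurableTypeR R)
    (repr (LebesgueSpace.sort u))).
exact: (@Lebesgue_finite _ _ _ _ _ (lee1n 2) u).
Qed.

Definition L2_repr u : L2fun := Lfun_Sub (lee1n 2) (L2_fun_Lfun u).

Lemma ae_eq_Lnorm2 (f g : T -> R) :
  measurable_fun setT f -> measurable_fun setT g ->
  f = g %[ae mu] -> 'N[mu]_2%:E[EFin \o f]%E = 'N[mu]_2%:E[EFin \o g]%E.
Proof.
move=> mf mg fg; rewrite unlock /Lnorm; congr (_ `^ _)%E.
have mp (h : T -> R) : measurable_fun setT h ->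
    measurable_fun setT (EFin \o (fun x => `|h x| `^ 2)).
  move=> mh; apply/measurable_EFinP.
  by apply: (measurableT_comp (measurable_powR _)); exact: measurableT_comp.
apply: ae_eq_integral => //; [exact: mp|exact: mp|].
by apply: filterS fg => x /= /[apply] ->.
Qed.

Section class.
Variable f : L2fun.

Definition L2_mfun : {mfun T >-> measurableTypeR R} :=
  HB.pack (f : T -> measurableTypeR R)
    (isMeasurableFun.Build _ _ T (measurableTypeR R) f (measurable_funPT f)).

Definition L2_pi : {mfun_ mu, T >-> measurableTypeR R} :=
  \pi_({mfun_ mu, T >-> measurableTypeR R})%qT L2_mfun.

Lemma L2_piE : (L2_pi : T -> R) = f %[ae mu].
Proof.
have /eqmodP/asboolP :
    repr L2_pi = L2_mfun %[mod {mfun_ mu, T >-> measurableTypeR R}]%qT.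
  by rewrite reprK.
exact.
Qed.

Lemma L2_pi_finite : finite_norm mu 2%:E L2_pi.
Proof.
rewrite /finite_norm (ae_eq_Lnorm2 _ _ L2_piE)//.
- exact: Lfunction_finite.
- exact: (@measurable_funPT _ _ T (measurableTypeR R) (repr L2_pi)).
Qed.

Definition L2_class : L2 :=
  HB.pack L2_pi (isFinLebesgue.Build _ _ _ mu _ (lee1n 2) L2_pi L2_pi_finite).
End class.

Lemma L2_reprE f : (L2_repr (L2_class f) : T -> R) = f %[ae mu].
Proof. exact: L2_piE. Qed.

Lemma L2_classP f g : L2_class f = L2_class g <-> (f : T -> R) = g %[ae mu].
Proof.
split=> [fg|fg].
  have := L2_reprE f; rewrite fg => h; apply: ae_eq_trans (L2_reprE g).
  exact: ae_eq_sym.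
have e : L2_pi f = L2_pi g by apply/eqmodP/asboolP.
rewrite /L2_class; move: (L2_pi_finite f) (L2_pi_finite g); rewrite e => p q.
by rewrite (Prop_irrelevance p q).
Qed.

Lemma L2_reprK : cancel L2_repr L2_class.
Proof.
move=> u.
have e : L2_pi (L2_repr u) = LebesgueSpace.sort u.
  by rewrite -[RHS]reprK; apply/eqmodP/asboolP; exact: ae_eq_refl.
rewrite /L2_class; move: (L2_pi_finite (L2_repr u)); rewrite e => p.
case: u e p => [u [[q]]] e p /=; rewrite -/(LebesgueSpace.sort _).
by rewrite (Prop_irrelevance p q).
Qed.

HB.instance Definition _ := gen_eqMixin L2.
HB.instance Definition _ := gen_choiceMixin L2.

Definition L2_zero : L2 := L2_class 0.
Definition L2_opp u : L2 := L2_class (- L2_repr u).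
Definition L2_add u v : L2 := L2_class (L2_repr u + L2_repr v).
Definition L2_scale (a : R) u : L2 := L2_class (a *: L2_repr u).

Lemma L2_addE f g : L2_add (L2_class f) (L2_class g) = L2_class (f + g).
Proof.
apply/L2_classP; apply: filterS2 (L2_reprE f) (L2_reprE g) => x fx gx _.
exact: (congr2 +%R (fx I) (gx I)).
Qed.

Lemma L2_oppE f : L2_opp (L2_class f) = L2_class (- f).
Proof.
apply/L2_classP; apply: filterS (L2_reprE f) => x fx _.
exact: (congr1 -%R (fx I)).
Qed.

Lemma L2_scaleE a f : L2_scale a (L2_class f) = L2_class (a *: f).
Proof.
apply/L2_classP; apply: filterS (L2_reprE f) => x fx _.
exact: (congr1 ( *%R a) (fx I)).
Qed.

Lemma L2_ind (P : L2 -> Prop) : (forall f, P (L2_class f)) -> forall u, P u.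
Proof. by move=> Pc u; rewrite -(L2_reprK u). Qed.

Lemma L2_addA : associative L2_add.
Proof.
by elim/L2_ind=> f; elim/L2_ind=> g; elim/L2_ind=> h; rewrite !L2_addE addrA.
Qed.

Lemma L2_addC : commutative L2_add.
Proof. by elim/L2_ind=> f; elim/L2_ind=> g; rewrite !L2_addE addrC. Qed.

Lemma L2_add0 : left_id L2_zero L2_add.
Proof. by elim/L2_ind=> f; rewrite L2_addE add0r. Qed.

Lemma L2_addN : left_inverse L2_zero L2_opp L2_add.
Proof. by elim/L2_ind=> f; rewrite L2_oppE L2_addE addNr. Qed.

HB.instance Definition _ :=
  GRing.isZmodule.Build L2 L2_addA L2_addC L2_add0 L2_addN.

Lemma L2_scaleA a b u : L2_scale a (L2_scale b u) = L2_scale (a * b) u.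
Proof. by elim/L2_ind: u => f; rewrite !L2_scaleE scalerA. Qed.

Lemma L2_scale1 : left_id 1 L2_scale.
Proof. by elim/L2_ind=> f; rewrite L2_scaleE scale1r. Qed.

Lemma L2_scaleDr : right_distributive L2_scale +%R.
Proof.
move=> a; elim/L2_ind=> f; elim/L2_ind=> g.
by rewrite /= [_ + _]L2_addE !L2_scaleE [RHS]L2_addE scalerDr.
Qed.

Lemma L2_scaleDl u : {morph L2_scale^~ u : a b / a + b}.
Proof.
by elim/L2_ind: u => f a b; rewrite !L2_scaleE [RHS]L2_addE scalerDl.
Qed.

HB.instance Definition _ := GRing.Zmodule_isLmodule.Build R L2
  L2_scaleA L2_scale1 L2_scaleDr L2_scaleDl.

Lemma L2_class_is_linear : linear L2_class.
Proof. by move=> a f g; rewrite -L2_addE -L2_scaleE. Qed.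

HB.instance Definition _ := GRing.isLinear.Build R L2fun L2 _ L2_class
  L2_class_is_linear.

Definition L2_dot u v : R := \int[mu]_x (L2_repr u x * L2_repr v x).

Lemma integrable_L2fun_mul f g :
  mu.-integrable setT (EFin \o (fun x => f x * g x)).
Proof.
by apply/Lfun1_integrable; apply: Lfun2_mul_Lfun1; exact: LfunP.
Qed.

Lemma L2_dotE f g :
  L2_dot (L2_class f) (L2_class g) = \int[mu]_x (f x * g x).
Proof.
congr fine; apply: ae_eq_integral => //.
- exact: (measurable_int mu (integrable_L2fun_mul _ _)).
- exact: (measurable_int mu (integrable_L2fun_mul _ _)).
by apply: filterS2 (L2_reprE f) (L2_reprE g) => x /= fx gx _; rewrite fx ?gx.
Qed.

Lemma L2_dotC u v : L2_dot u v = L2_dot v u.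
Proof. by apply: eq_Rintegral => x _; rewrite mulrC. Qed.

Lemma L2_dot_linear u : linear_for *%R (L2_dot u).
Proof.
elim/L2_ind: u => h a; elim/L2_ind=> f; elim/L2_ind=> g.
rewrite -linearP !L2_dotE -RintegralZl//; last exact: integrable_L2fun_mul.
rewrite -RintegralD//; last exact: integrable_L2fun_mul.
  by apply: eq_Rintegral => x _; rewrite /= mulrDr mulrCA.
exact: (integrableZl _ _ (integrable_L2fun_mul h f)).
Qed.

Lemma L2_dot_bilinear : bilinear_for *%R *%R L2_dot.
Proof.
split=> u; last exact: L2_dot_linear.
by move=> a v w; rewrite !(L2_dotC _ u) L2_dot_linear.
Qed.

Lemma L2_dot_sym u v : L2_dot u v = (-1) ^+ false * idfun (L2_dot v u).
Proof. by rewrite expr0 mul1r L2_dotC. Qed.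

Lemma L2_dot_gt0 u : u != 0 -> 0 < L2_dot u u.
Proof.
elim/L2_ind: u => f f0; rewrite L2_dotE lt_neqAle.
apply/andP; split; last first.
  by apply: Rintegral_ge0 => x _; rewrite -expr2 sqr_ge0.
apply: contraNneq f0 => int0; apply/eqP.
have /ae_eq_integral_abs : (\int[mu]_x `|(f x * f x)%:E| = 0)%E.
  under eq_integral do rewrite /= ger0_norm ?[_ * _]mulr_ge0 -?expr2 ?sqr_ge0//.
  rewrite -[LHS]fineK; first by congr EFin; exact/esym.
  exact: (integrable_fin_num _ (integrable_L2fun_mul f f)).
have mff := measurable_int mu (integrable_L2fun_mul f f).
move=> /(_ measurableT mff) ff0; apply/L2_classP.
by apply: filterS ff0 => x /= /[apply] -[] /eqP; rewrite mulf_eq0 orbb => /eqP.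
Qed.

HB.instance Definition _ :=
  bilinear_isBilinear.Build R L2 L2 R *%R *%R L2_dot L2_dot_bilinear.
HB.instance Definition _ :=
  isHermitianSesquilinear.Build R L2 false idfun L2_dot L2_dot_sym.
HB.instance Definition _ := isDotProduct.Build R L2 L2_dot L2_dot_gt0.
End L2.

Definition lin_span (R : realType) (V : lmodType R) (B : set V) : set V :=
  [set v | exists s : seq (R * V),
     {in s, forall p, B p.2} /\ v = \sum_(p <- s) p.1 *: p.2].

(* An orthonormal set whose linear span (finite combinations) is dense. *)
Definition orthonormal_basis (R : realType) (V : lmodType R)
    (dot : {dot V for idfun}) (B : set V) :=
  (forall u v, B u -> B v -> dot u v = (u == v)%:R) /\
  (forall v (e : R), 0 < e ->
     exists2 w, lin_span B w & Num.sqrt (dot (v - w) (v - w)) < e).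

Lemma Lfun2_bounded d (T : measurableType d) (R : realType)
    (mu : {finite_measure set T -> \bar R}) (f : T -> R) (M : R) :
  measurable_fun setT f -> (forall x, `|f x| <= M) -> f \in Lfun mu 2%:E.
Proof.
move=> mf fM; rewrite inE; apply/andP; split; rewrite inE//=.
rewrite /finite_norm unlock poweR_lty//.
apply: (@le_lt_trans _ _ (\int[mu]_x (M `^ 2)%:E)%E).
  apply: ge0_le_integral => //.
  - by move=> x _; rewrite poweR_ge0.
  - apply/measurable_EFinP; apply: (measurableT_comp (measurable_powR _)).
    exact: measurableT_comp.
  - move=> x _ /=; rewrite lee_fin ge0_ler_powR// ?nnegrE//.
    by rewrite (le_trans _ (fM x)).
rewrite integral_cst// lte_mul_pinfty ?lee_fin ?powR_ge0//.
by rewrite -ge0_fin_numE// fin_num_measure.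
Qed.

Section cube.
Context (R : realType).
Notation Rn n := (n.-tuple (measurableTypeR R)).

Lemma measurable_box n (A : 'I_n -> set (measurableTypeR R)) :
  (forall i, measurable (A i)) ->
  measurable [set x : Rn n | forall i, A i (tnth x i)].
Proof.
move=> mA.
rewrite (_ : [set x | _] =
    \bigcap_(i in [set: 'I_n]) ((@tnth n _)^~ i @^-1` A i)).
  apply: fin_bigcap_measurable => // i _.
  by rewrite -[X in measurable X]setTI; exact: measurable_tnth.
apply/seteqP; split=> x /= h i; first by move=> _; exact: (h i).
exact: (h i I).
Qed.

Lemma lebesgue_tuple_box n (A : 'I_n -> set (measurableTypeR R)) :
  (forall i, measurable (A i)) ->
  lebesgue_tuple n [set x | forall i, A i (tnth x i)] =
  (\prod_(i < n) lebesgue_measure (A i))%E.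
Proof.
elim: n => [|n IH] in A *; move=> mA.
  by rewrite big_ord0 /= diracE mem_set// => -[].
rewrite big_ord_recl -IH; last by move=> i; exact: mA.
rewrite /= /lebesgue_cons /pushforward -product_measure1E//; last first.
  by apply: (@measurable_box n (fun i => A (lift ord0 i))) => i; exact: mA.
congr (_ _); apply/seteqP; split => -[x t] /=.
  move=> h; split; first exact: (h ord0).
  by move=> i; have := h (lift ord0 i); rewrite tnthS.
move=> [h0 h] i; have [j ->|->//] := unliftP ord0 i.
by rewrite tnthS; exact: h.
Qed.

Definition unit_cube n : set (Rn n) := [set x | forall i, 0 < tnth x i < 1].
Arguments unit_cube : clear implicits.

Lemma measurable_unit_cube n : measurable (unit_cube n).
Proof.
apply: (@measurable_box n (fun=> [set r | 0 < r < 1])) => i.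
by rewrite -set_itvoo; exact: measurable_itv.
Qed.

Arguments measurable_unit_cube : clear implicits.

Lemma lebesgue_unit_cube n : lebesgue_tuple n (unit_cube n) = 1%E.
Proof.
have := @lebesgue_tuple_box n (fun=> `]0, 1[%classic) (fun=> measurable_itv _).
rewrite big1 => [<-|i _].
  by congr (lebesgue_tuple n _); apply/seteqP; split=> x /= h i;
    have := h i; rewrite /= in_itv.
by rewrite lebesgue_measure_itv/= lte01 oppr0 adde0.
Qed.

Lemma lebesgue_unit_cube_fin n : (lebesgue_tuple n (unit_cube n) < +oo)%E.
Proof. by rewrite lebesgue_unit_cube ltry. Qed.

(* L2 of this measure is L2((0,1)^n): functions live on the whole of R^n but
   their values outside the open cube are irrelevant almost everywhere. *)
Definition cube_measure n : {finite_measure set (Rn n) -> \bar R} :=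
  mfrestr (measurable_unit_cube n) (lebesgue_unit_cube_fin n).

(* k \succ 0: the first non-zero entry of k is positive (so k != 0). *)
Definition lex_pos n (k : n.-tuple int) :=
  exists i : 'I_n, 0 < tnth k i /\ forall j : 'I_n, (j < i)%N -> tnth k j = 0.

Definition scalar_prod n (k : n.-tuple int) (x : Rn n) : R :=
  \sum_(i < n) (tnth k i)%:~R * (tnth x i : R).

Definition cos_fun n k (x : Rn n) : R :=
  Num.sqrt 2 * cos (2 * pi * scalar_prod k x).
Definition sin_fun n k (x : Rn n) : R :=
  Num.sqrt 2 * sin (2 * pi * scalar_prod k x).

Lemma measurable_scalar_prod n (k : n.-tuple int) :
  measurable_fun setT (scalar_prod k).
Proof.
apply: measurable_sum => i; apply: measurable_funM => //.
exact: measurable_tnth.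
Qed.

Lemma cos_fun_Lfun n k : @cos_fun n k \in Lfun (cube_measure n) 2%:E.
Proof.
apply: (@Lfun2_bounded _ _ _ _ _ (Num.sqrt 2)) => [|x].
  apply: measurable_funM => //.
  apply: (measurableT_comp (continuous_measurable_fun (@continuous_cos R))).
  by apply: measurable_funM => //; exact: measurable_scalar_prod.
rewrite normrM ger0_norm ?sqrtr_ge0// ler_piMr ?sqrtr_ge0//.
by rewrite ler_norml cos_geN1 cos_le1.
Qed.

Lemma sin_fun_Lfun n k : @sin_fun n k \in Lfun (cube_measure n) 2%:E.
Proof.
apply: (@Lfun2_bounded _ _ _ _ _ (Num.sqrt 2)) => [|x].
  apply: measurable_funM => //.
  apply: (measurableT_comp (continuous_measurable_fun (@continuous_sin R))).
  by apply: measurable_funM => //; exact: measurable_scalar_prod.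
rewrite normrM ger0_norm ?sqrtr_ge0// ler_piMr ?sqrtr_ge0//.
by rewrite ler_norml sin_geN1 sin_le1.
Qed.

Definition one_L2 n : L2 (cube_measure n) :=
  L2_class (Lfun_Sub _ (Lfun_cst (cube_measure n) 1 2)).
Definition cos_L2 n k : L2 (cube_measure n) :=
  L2_class (Lfun_Sub _ (cos_fun_Lfun k)).
Definition sin_L2 n k : L2 (cube_measure n) :=
  L2_class (Lfun_Sub _ (sin_fun_Lfun k)).

Definition trig_system n : set (L2 (cube_measure n)) :=
  [set one_L2 n] `|` [set cos_L2 k | k in @lex_pos n]
    `|` [set sin_L2 k | k in @lex_pos n].
End cube.
Arguments trig_system : clear implicits.

(* Main.v *)
(* Write wave k t for cos (2 pi k.x + t); sines and the constant 1 are waves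
   too.  By Fubini, the integral of wave k t over the cube is cos t if k = 0 and
   0 otherwise, and the product formula for cosines turns this into
   orthonormality.

   For density, consider the class of functions obtained from waves by linear
   combinations and pointwise limits on the cube of uniformly bounded
   sequences.  By dominated convergence it lies in the L2-closure of the span.
   It is an algebra, closed under exp, so it contains the indicator of {f > 0}
   whenever it contains f; hence the sets whose indicator it contains form a
   sigma-algebra.  This sigma-algebra contains the half-spaces {x_i > c},
   because inside the cube these are the sets where
   cos (pi c) - cos (2 pi x_i - pi c) > 0.  So the closure contains all simple
   functions, and then all of L2. *)
Require Import Defs.
From mathcomp Require Import all_boot all_order all_algebra.
From mathcomp Require Import all_classical all_reals all_analysis.
From mathcomp Require Import measurable_realfun ring lra.

Set Implicit Arguments.
Unset Strict Implicit.
Unset Printing Implicit Defensive.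

Import Order.TTheory GRing.Theory Num.Theory.
Import numFieldNormedType.Exports.

Local Open Scope classical_set_scope.
Local Open Scope ring_scope.

(** * Linear spans and bounds on limits *)

Section lin_span_closed.
Context (R : realType) (V : lmodType R) (B : set V).

Lemma lin_span_gen v : B v -> lin_span B v.
Proof.
move=> Bv; exists [:: (1, v)]; split; last by rewrite big_seq1 scale1r.
by move=> p /[!inE] /eqP ->.
Qed.

Lemma lin_spanD u v : lin_span B u -> lin_span B v -> lin_span B (u + v).
Proof.
move=> [s [Bs ->]] [t [Bt ->]]; exists (s ++ t); rewrite big_cat; split => //.
by move=> p; rewrite mem_cat => /orP[/Bs|/Bt].
Qed.

Lemma lin_spanZ a v : lin_span B v -> lin_span B (a *: v).
Proof.
move=> [s [Bs ->]]; exists [seq (a * p.1, p.2) | p <- s]; split.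
  by move=> _ /mapP[p /Bs Bp ->].
by rewrite scaler_sumr big_map; apply: eq_bigr => p _; rewrite scalerA.
Qed.
End lin_span_closed.

Lemma cvgn_norm_le (R : realType) (u : nat -> R) (l C : R) :
  u @ \oo --> l -> (forall m, `|u m| <= C) -> `|l| <= C.
Proof.
move=> /cvg_norm ul uC; rewrite -(cvg_lim _ ul)//.
apply: limr_le; last exact: nearW.
by apply/cvg_ex; exists `|l|.
Qed.

(** * Mean-square approximation by the span *)

Section L2_approx.
Context d (T : measurableType d) (R : realType).
Variable mu : {measure set T -> \bar R}.
Variables (B : set (L2 mu)) (D : set T) (mD : measurable D).
Implicit Types (f g h : T -> R).

Definition sqr_dist f g := (\int[mu]_(x in D) ((f x - g x) ^+ 2)%:E)%E.

(** [f] is a plain function, not assumed square-integrable, so that pointwise limits can be taken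
    without forming classes. The distance is kept squared and extended-real, which avoids roots and
    finiteness conditions until the very end. *)
Definition L2_approx f := forall e : R, 0 < e ->
  exists2 p : L2fun mu, lin_span B (L2_class p) & (sqr_dist f p < e%:E)%E.

Lemma measurable_sqr_dist f g : measurable_fun D f -> measurable_fun D g ->
  measurable_fun D (fun x => ((f x - g x) ^+ 2)%:E).
Proof.
move=> mf mg; apply/measurable_EFinP; apply: measurable_funX.
exact: measurable_funB.
Qed.

Lemma measurable_L2fun (p : L2fun mu) : measurable_fun D p.
Proof. exact: measurable_funTS (measurable_funPT p). Qed.

(** Integrate [(a + b) ^+ 2 <= 2 * a ^+ 2 + 2 * b ^+ 2], which amounts to [0 <= (a - b) ^+ 2]. Each
    half then contributes twice [e / 4]. *)
Lemma sqr_dist_triangle f g h (e : R) : measurable_fun D f ->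
  measurable_fun D g -> measurable_fun D h ->
  (sqr_dist f g < (e / 4)%:E)%E -> (sqr_dist g h < (e / 4)%:E)%E ->
  (sqr_dist f h < e%:E)%E.
Proof.
move=> mf mg mh fg gh.
have m := measurable_sqr_dist.
have ge0 (u v : T -> R) x : D x -> (0 <= ((u x - v x) ^+ 2)%:E)%E.
  by rewrite lee_fin sqr_ge0.
apply: (@le_lt_trans _ _ (2%:E * sqr_dist f g + 2%:E * sqr_dist g h)%E).
  have ge02 (u v : T -> R) x : D x ->
      (0 <= 2%:E * ((u x - v x) ^+ 2)%:E :> \bar R)%E.
    by move=> Dx; rewrite mule_ge0//; exact: ge0.
  have m2 (u v : T -> R) : measurable_fun D u -> measurable_fun D v ->
      measurable_fun D (fun x => 2%:E * ((u x - v x) ^+ 2)%:E)%E.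
    by move=> mu' mv; apply: measurable_funeM; exact: m.
  rewrite -!ge0_integralZl//; try exact: m; try exact: ge0.
  rewrite -ge0_integralD//; try exact: m2; try exact: ge02.
  apply: ge0_le_integral => //; first exact: ge0.
  - exact: m.
  - by apply: emeasurable_funD; exact: m2.
  - move=> x _; rewrite -!EFinM -EFinD lee_fin.
    have := sqr_ge0 ((f x - g x) - (g x - h x)); nra.
have -> : e%:E = (2%:E * (e / 4)%:E + 2%:E * (e / 4)%:E)%E.
  by rewrite -!EFinM -EFinD; congr EFin; lra.
by apply: lteD; rewrite lte_pmul2l.
Qed.

Lemma L2_approxD f g : measurable_fun D f -> measurable_fun D g ->
  L2_approx f -> L2_approx g -> L2_approx (f \+ g).
Proof.
move=> mf mg af ag e e0; have e4 : 0 < e / 4 by rewrite divr_gt0.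
have [p Bp fp] := af _ e4; have [q Bq gq] := ag _ e4.
exists (p + q); first by rewrite linearD; exact: lin_spanD.
have mp := measurable_L2fun p; have mq := measurable_L2fun q.
apply: (@sqr_dist_triangle _ (p \+ g)).
- exact: measurable_funD.
- exact: measurable_funD.
- exact: (measurable_L2fun (p + q)).
- apply: le_lt_trans fp; rewrite le_eqVlt; apply/orP; left; apply/eqP.
  by apply: eq_integral => x _ /=; congr (_ ^+ 2)%:E; ring.
- apply: le_lt_trans gq; rewrite le_eqVlt; apply/orP; left; apply/eqP.
  apply: eq_integral => x _; congr (_ ^+ 2)%:E.
  by have -> : (p + q : L2fun mu) x = p x + q x by []; rewrite /=; ring.
Qed.

Lemma L2_approxZ a f : measurable_fun D f ->
  L2_approx f -> L2_approx (fun x => a * f x).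
Proof.
move=> mf af e e0.
(* The true factor is [a ^+ 2]; adding 1 keeps the division by it legitimate when [a = 0]. *)
have a0 : 0 < a ^+ 2 + 1 by rewrite ltr_wpDl// sqr_ge0.
have [p Bp fp] := af (e / (a ^+ 2 + 1)) (divr_gt0 e0 a0).
exists (a *: p); first by rewrite linearZ; exact: lin_spanZ.
have mfp := measurable_sqr_dist mf (measurable_L2fun p).
apply: (@le_lt_trans _ _ ((a ^+ 2 + 1)%:E * sqr_dist f p)%E).
  rewrite -ge0_integralZl//; last first.
  - by rewrite lee_fin ltW.
  - by move=> x _; rewrite lee_fin sqr_ge0.
  apply: ge0_le_integral => //.
  - by move=> x _; rewrite lee_fin sqr_ge0.
  - apply: measurable_sqr_dist; first exact: measurable_funM.
    exact: (measurable_L2fun (a *: p)).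
  - exact: measurable_funeM.
  - move=> x _; rewrite -EFinM lee_fin.
    have -> : (a * f x - (a *: p : L2fun mu) x) = a * (f x - p x).
      by rewrite mulrBr.
    by rewrite exprMn ler_wpM2r ?sqr_ge0// lerDl.
rewrite -(@lte_pmul2l _ (a ^+ 2 + 1)%:E) ?lte_fin// in fp.
apply: (lt_le_trans fp).
by rewrite -EFinM mulrC divfK// gt_eqF.
Qed.

(** The bound by [g] passes to the limit [f], so [(f - f_ m) ^+ 2] is dominated by [4 * g ^+ 2] and
    its integral tends to 0 by dominated convergence. An approximant of a late [f_ m] then serves
    for [f]. *)
Lemma L2_approx_lim (f_ : nat -> T -> R) f g :
  (forall m, measurable_fun D (f_ m)) -> measurable_fun D f ->
  mu.-integrable D (fun x => (g x ^+ 2)%:E) ->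
  (forall m x, D x -> `|f_ m x| <= g x) ->
  (forall x, D x -> f_ ^~ x @ \oo --> f x) ->
  (forall m, L2_approx (f_ m)) -> L2_approx f.
Proof.
move=> mf_ mf ig fg ff af e e0; have e4 : 0 < e / 4 by rewrite divr_gt0.
have fg' x : D x -> `|f x| <= g x.
  by move=> Dx; apply: (cvgn_norm_le (ff x Dx)) => m; exact: fg.
have [] := @dominated_convergence _ _ _ mu _ mD
  (fun m x => ((f x - f_ m x) ^+ 2)%:E) (cst 0%E)
  (fun x => 4%:E * (g x ^+ 2)%:E)%E
  (fun m => measurable_sqr_dist mf (mf_ m)) (measurable_cst _).
- apply: aeW => x Dx; apply: cvg_EFin; first by apply: nearW.
  rewrite [X in _ --> X](_ : _ = (f x - f x) * (f x - f x)); last first.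
    by rewrite subrr mulr0.
  by apply: cvgM; apply: cvgB; (exact: cvg_cst || exact: ff).
- exact: integrableZl.
- apply: aeW => x m Dx; rewrite -EFinM/= lee_fin ger0_norm ?sqr_ge0//.
  have := fg' x Dx; have := fg m x Dx; rewrite !ler_norml.
  by move=> /andP[? ?] /andP[? ?]; nra.
move=> _ _; rewrite integral0 => /fine_cvgP[fin /cvgr_lt /(_ _ e4) small].
have [m [finm smallm]] : exists m, sqr_dist f (f_ m) \is a fin_num /\
    fine (sqr_dist f (f_ m)) < e / 4.
  have [m _ fs] := filterI fin small.
  by exists m; exact: (fs m (leqnn m)).
have [p Bp fp] := af m _ e4; exists p => //.
apply: (@sqr_dist_triangle _ (f_ m)) => //; first exact: measurable_L2fun.
by rewrite -(fineK finm) lte_fin.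
Qed.

End L2_approx.

(** * The class generated by linear combinations and bounded pointwise limits *)

Section bounded_limits.
Context (T : Type) (R : realType) (D : set T) (G : set (T -> R)).
Implicit Types (f g : T -> R) (A : set T).

(** Limits may be iterated at will, and properties are proved by induction on how a function was
    built. Bounds and convergence are asked on [D] only, so the values outside [D] are
    immaterial. *)
Inductive bounded_limits : (T -> R) -> Prop :=
| bl_gen f : G f -> bounded_limits f
| bl_add f g : bounded_limits f -> bounded_limits g -> bounded_limits (f \+ g)
| bl_scale a f : bounded_limits f -> bounded_limits (fun x => a * f x)
| bl_lim (f_ : nat -> T -> R) f C : (forall m, bounded_limits (f_ m)) ->
    (forall m x, D x -> `|f_ m x| <= C) ->
    (forall x, D x -> f_ ^~ x @ \oo --> f x) -> bounded_limits f.

Hypothesis G1 : bounded_limits (cst 1).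
Hypothesis GM : forall f g, G f -> G g -> bounded_limits (f \* g).
Hypothesis G_bounded : forall f, G f -> exists C, forall x, D x -> `|f x| <= C.

Lemma bl_bounded h : bounded_limits h -> exists C, forall x, D x -> `|h x| <= C.
Proof.
elim=> {h} [h /G_bounded//|h1 h2 _ [C hC] _ [C' hC']|a h _ [C hC]|].
- exists (C + C') => x Dx.
  by rewrite (le_trans (ler_normD _ _))// lerD ?hC ?hC'.
- by exists (`|a| * C) => x Dx; rewrite normrM ler_wpM2l ?hC.
- move=> h_ h C _ _ hC h_h; exists C => x Dx.
  by apply: (cvgn_norm_le (h_h x Dx)) => m; exact: hC.
Qed.

(** The constant sequence [f] is bounded and converges on [D] to [g], so [bl_lim] applies. *)
Lemma bl_eq f g : (forall x, D x -> f x = g x) ->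
  bounded_limits f -> bounded_limits g.
Proof.
move=> fg blf; have [C fC] := bl_bounded blf.
apply: (@bl_lim (fun=> f) g C) => // x Dx.
by rewrite -fg//; exact: cvg_cst.
Qed.

(** Double induction, on [f] and, when [f] is a generator, on [g]. Limits cause no trouble because
    multiplying by a fixed bounded function preserves bounded convergence. *)
Lemma bl_mul f g :
  bounded_limits f -> bounded_limits g -> bounded_limits (f \* g).
Proof.
move=> blf.
elim: blf g => {f} [f Gf g|f f' _ IHf _ IHf' g blg|a f _ IHf g blg|].
- elim=> {g} [g|g g' _ IHg _ IHg'|a g _ IHg|g_ g C blg IHg gC gg].
  + exact: GM.
  + rewrite [X in bounded_limits X](_ : _ = (f \* g) \+ (f \* g')).
      exact: bl_add.
    by apply/funext => x /=; rewrite mulrDr.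
  + rewrite [X in bounded_limits X](_ : _ = fun x => a * (f \* g) x).
      exact: bl_scale.
    by apply/funext => x /=; rewrite mulrCA.
  + have [C' fC'] := G_bounded Gf.
    apply: (@bl_lim _ _ (C' * C) IHg) => [m x Dx|x Dx].
      by rewrite normrM ler_pM ?fC' ?gC.
    by apply: cvgM; [exact: cvg_cst|exact: gg].
- rewrite [X in bounded_limits X](_ : _ = (f \* g) \+ (f' \* g)).
    by apply: bl_add; [exact: IHf|exact: IHf'].
  by apply/funext => x /=; rewrite mulrDl.
- rewrite [X in bounded_limits X](_ : _ = fun x => a * (f \* g) x).
    by apply: bl_scale; exact: IHf.
  by apply/funext => x /=; rewrite mulrA.
- move=> f_ f C _ IHf fC ff g blg; have [C' gC'] := bl_bounded blg.
  apply: (@bl_lim _ _ (C * C') (fun m => IHf m g blg)) => [m x Dx|x Dx].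
    by rewrite normrM ler_pM ?fC ?gC'.
  by apply: cvgM; [exact: ff|exact: cvg_cst].
Qed.

Lemma bl_cst a : bounded_limits (cst a).
Proof.
rewrite [X in bounded_limits X](_ : _ = fun x => a * @cst T R 1 x).
  exact: bl_scale.
by apply/funext => x /=; rewrite mulr1.
Qed.

Lemma bl_expn f m : bounded_limits f -> bounded_limits (fun x => f x ^+ m).
Proof.
move=> blf; elim: m => [|m IH]; first exact: G1.
rewrite [X in bounded_limits X](_ : _ = f \* (fun x => f x ^+ m)).
  exact: bl_mul.
by apply/funext => x /=; rewrite exprS.
Qed.

Lemma bl_sum (I : Type) (s : seq I) (f_ : I -> T -> R) :
  (forall i, bounded_limits (f_ i)) ->
  bounded_limits (fun x => \sum_(i <- s) f_ i x).
Proof.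
move=> blf; elim: s => [|i s IH].
  by apply: bl_eq (bl_cst 0) => x _; rewrite big_nil.
by apply: bl_eq (bl_add (blf i) IH) => x _; rewrite big_cons.
Qed.

(** The partial sums of the exponential series are polynomials in [f]. If [C] bounds [|f|] on [D],
    they are all bounded there by [expR C]. *)
Lemma bl_expR f : bounded_limits f -> bounded_limits (expR \o f).
Proof.
move=> blf; have [C fC] := bl_bounded blf.
apply: (@bl_lim (fun m x => series (exp_coeff (f x)) m) _ (expR C)).
- move=> m; rewrite /series /=; apply: bl_sum => i.
  by apply: bl_eq (bl_scale (i`!%:R)^-1 (bl_expn i blf)) => x _; rewrite mulrC.
- move=> m x Dx; apply: (@le_trans _ _ (series (exp_coeff `|f x|) m)).
    rewrite -normed_series_exp_coeff; exact: ler_norm_sum.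
  apply: (@le_trans _ _ (expR `|f x|)); last by rewrite ler_expR fC.
  apply: nondecreasing_cvgn_le; last exact: is_cvg_series_exp_coeff.
  by apply: nondecreasing_series => i _ _; exact: exp_coeff_ge0.
- by move=> x Dx; exact: is_cvg_series_exp_coeff.
Qed.

(* The indicator of {f > 0} is the limit of exp (- exp (m - m ^ 2 f)). *)
Lemma bl_indic_gt0 f : bounded_limits f ->
  bounded_limits \1_[set x | 0 < f x].
Proof.
move=> blf.
pose u (m : nat) (t : R) : R := expR (- expR (m%:R - m%:R ^+ 2 * t)).
(* From [1 + m <= expR m]. This gives an explicit null sequence for squeezing in both cases
   below. *)
have le_harmonic (m : nat) : expR (- m%:R : R) <= harmonic m.
  rewrite expRN lef_pV2 ?posrE ?expR_gt0//; apply: le_trans (expR_ge1Dx _).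
  by rewrite -natr1 addrC.
apply: (@bl_lim (fun m => u m \o f) _ 1).
- move=> m; apply: bl_expR.
  have bE : bounded_limits (fun x => m%:R + - (m%:R ^+ 2) * f x).
    by apply: (bl_add (bl_cst m%:R)); exact: bl_scale.
  apply: bl_eq (bl_scale (-1) (bl_expR bE)) => x _ /=.
  by rewrite mulN1r mulNr.
- move=> m x Dx; rewrite ger0_norm ?expR_ge0//.
  by rewrite /= /u -[leRHS]expR0 ler_expR oppr_le0 expR_ge0.
move=> x Dx; rewrite indicE; have [fx|fx] := ltP 0 (f x).
  (* Where [f x > 0]: as soon as [m >= 2 / f x], the inner exponent [m - m ^ 2 * f x] is at most
     [- m], hence [u m (f x) >= 1 - expR (- m)]. *)
  rewrite mem_set//=.
  apply: (@squeeze_cvgr _ _ _ _ (fun m => 1 - harmonic m) (cst 1));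
    last 2 first.
  - rewrite -[X in _ --> X]subr0.
    by apply: cvgB; [exact: cvg_cst|exact: cvg_harmonic].
  - exact: cvg_cst.
  near=> m; apply/andP; split; last first.
    by rewrite /u -[leRHS]expR0 ler_expR oppr_le0 expR_ge0.
  apply: le_trans (expR_ge1Dx _); rewrite lerD2l lerN2.
  apply: le_trans (le_harmonic m); rewrite ler_expR.
  have m2 : 2 / f x <= m%:R by near: m; exact: nbhs_infty_ger.
  rewrite ler_pdivrMr// in m2.
  by have : 0 <= m%:R :> R by []; nra.
(* Where [f x <= 0]: the inner exponential is at least [1 + m - m ^ 2 * f x >= m], hence
   [u m (f x) <= expR (- m)]. *)
rewrite memNset/=; last by apply/negP; rewrite -leNgt.
apply: (@squeeze_cvgr _ _ _ _ (cst 0) harmonic); last 2 first.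
- exact: cvg_cst.
- exact: cvg_harmonic.
apply: nearW => m; rewrite expR_ge0/=; apply: le_trans (le_harmonic m).
rewrite /u ler_expR lerN2; apply: le_trans (expR_ge1Dx _).
have : m%:R ^+ 2 * f x <= 0 by rewrite mulr_ge0_le0// sqr_ge0.
by lra.
Unshelve. all: by end_near.
Qed.

Lemma bl_indicC A : bounded_limits \1_A -> bounded_limits \1_(~` A).
Proof.
move=> blA; apply: bl_eq (bl_add (bl_cst 1) (bl_scale (-1) blA)) => x _ /=.
by rewrite indicC indicE; case: (x \in A); rewrite mulN1r ?subrr ?subr0.
Qed.

Lemma bl_indic_sigma_algebra :
  sigma_algebra setT [set A | bounded_limits \1_A].
Proof.
split=> [|A blA|A blA] /=.
- by rewrite indic0; exact: bl_cst.
- by rewrite setTD; exact: bl_indicC.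
(* Finite unions come from complements and products of indicators. At each point the indicators of
   the partial unions are eventually constant, so the countable union is a limit bounded by 1. *)
have blU m : bounded_limits \1_(\big[setU/set0]_(i < m) A i).
  elim: m => [|m IH]; first by rewrite big_ord0 indic0; exact: bl_cst.
  rewrite big_ord_recr/= -[X in \1_X]setCK setCU.
  apply: bl_indicC; rewrite indicI; apply: bl_mul; apply: bl_indicC => //.
  exact: blA.
apply: (@bl_lim _ _ 1 blU) => [m x _|x _].
  by rewrite indicE; case: (_ \in _); rewrite ?normr1 ?normr0.
apply: cvg_near_cst; rewrite !indicE.
have [[k _ Akx]|NAx] := pselect ((\bigcup_k A k) x).
  exists k.+1 => // m /= km; rewrite indicE !mem_set//; first by exists k.
  by rewrite -bigcup_mkord; exists k.
apply: nearW => m; rewrite indicE !memNset// -bigcup_mkord.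
by move=> [k _ Akx]; apply: NAx; exists k.
Qed.
End bounded_limits.

(** * Waves and their integrals over the cube *)

Section trigonometric_system.
Context (R : realType).
Notation Rn n := (n.-tuple (measurableTypeR R)).
Notation leb n := (@lebesgue_tuple R n).
Notation cube n := (@unit_cube R n).
Notation mu n := (cube_measure R n).

(** This is [scalar_prod] with the frequency as a function, so that adding frequencies or dropping
    the first entry involves no tuples. *)
Definition phase n (k : 'I_n -> int) (x : Rn n) : R :=
  \sum_(i < n) (k i)%:~R * (tnth x i : R).

Definition wave n (k : 'I_n -> int) (t : R) (x : Rn n) : R :=
  cos (2 * pi * phase k x + t).

Lemma measurable_phase n (k : 'I_n -> int) t :
  measurable_fun setT (fun x : Rn n => 2 * pi * phase k x + t).
Proof.
apply: measurable_funD => //; apply: measurable_funM => //.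
apply: measurable_sum => i; apply: measurable_funM => //.
exact: measurable_tnth.
Qed.

Lemma measurable_wave n (k : 'I_n -> int) t : measurable_fun setT (wave k t).
Proof.
apply: (measurableT_comp (continuous_measurable_fun (@continuous_cos R))).
exact: measurable_phase.
Qed.

Lemma wave_bounded n (k : 'I_n -> int) t x : `|wave k t x| <= 1.
Proof. by rewrite ler_norml cos_geN1 cos_le1. Qed.

Lemma wave_mul n (k l : 'I_n -> int) s t x : wave k s x * wave l t x =
  2^-1 * (wave (fun i => k i + l i) (s + t) x +
          wave (fun i => k i - l i) (s - t) x).
Proof.
rewrite /wave; set a := 2 * pi * phase k x + s; set b := 2 * pi * phase l x + t.
have -> : 2 * pi * phase (fun i => k i + l i) x + (s + t) = a + b.
  rewrite /a /b addrACA -mulrDr -big_split; congr (_ * _ + _).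
  by apply: eq_bigr => i _; rewrite /= intrD mulrDl.
have -> : 2 * pi * phase (fun i => k i - l i) x + (s - t) = a - b.
  rewrite /a /b opprD addrACA -mulrN -mulrDr -sumrN -big_split.
  congr (_ * _ + _).
  by apply: eq_bigr => i _; rewrite /= intrB mulrBl.
by move: a b => a b; rewrite cosB cosD; field.
Qed.

Lemma sinD2pi_int (z : int) (t : R) : sin (2 * pi * z%:~R + t) = sin t.
Proof.
have P (m : nat) (a : R) : sin (a + 2 * pi * m%:R) = sin a.
  rewrite -[RHS](periodicn (@sinD2pi R) m a); congr (sin (_ + _)).
  by rewrite -[RHS]mulr_natr -(mulr_natl pi 2).
case: z => m; first by rewrite addrC P.
rewrite NegzE mulrNz -(P m.+1) pmulrn; congr sin; ring.
Qed.

Lemma is_derive_sin_affine (c t x : R) : c != 0 ->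
  is_derive x (1:R) (fun x => c^-1 * sin (c * x + t)) (cos (c*x + t)).
Proof.
move=> c0.
have d1 : is_derive x (1:R) (fun x => c * x + t) c.
  have := @is_deriveD _ _ _ (fun x => c * x) (cst t) x 1 c 0 _ _.
  rewrite addr0; apply.
  have := @is_deriveZ _ _ _ (@id R) c x 1 1 _.
  by rewrite /GRing.scale/= mulr1; apply; exact: is_derive_id.
have d2 : is_derive x (1:R) (fun x => sin (c * x + t)) (cos (c * x + t) * c).
  exact: (@is_derive1_comp _ sin (fun x => c * x + t) x _ _
    (is_derive_sin _) d1).
have := @is_deriveZ _ _ _ _ c^-1 _ _ _ d2.
rewrite [X in is_derive _ _ _ X](_ : _ = cos (c * x + t))//=.
by rewrite /GRing.scale/= mulrC mulfK.
Qed.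

(** For [k != 0] the primitive [c^-1 * sin (c * x + t)] takes the same value at 0 and 1, since [c]
    is an integer multiple of [2 * pi]. *)
Lemma integral_cos_itv01 (k : int) (t : R) :
  (\int[lebesgue_measure]_(x in `]0%R, 1%R[)
     (cos (2 * pi * (k%:~R * x) + t))%:E = ((k == 0)%:R * cos t)%:E)%E.
Proof.
have mcos : measurable_fun setT
    (fun x : R => (cos (2 * pi * (k%:~R * x) + t))%:E).
  apply/measurable_EFinP.
  apply: (measurableT_comp (continuous_measurable_fun (@continuous_cos R))).
  by apply: measurable_funD => //; do 2 apply: measurable_funM => //.
have [->|k0] := eqVneq k 0.
  under eq_integral do rewrite mul0r mulr0 add0r.
  rewrite integral_cst//= lebesgue_measure_itv/=.
  by rewrite lte01 oppr0 adde0 mule1 mul1r.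
(* The endpoints are null; the closed interval is what the fundamental theorem of calculus
   expects. *)
rewrite -(@integral_itv_bndoo _ _ _ _ true false); last exact: measurable_funTS.
have pk0 : 2 * pi * k%:~R != 0 :> R.
  by rewrite !mulf_neq0 ?intr_eq0// gt_eqF// pi_gt0.
pose c : R := 2 * pi * k%:~R.
have dF (x : R) : is_derive x (1:R) (fun x => c^-1 * sin (c * x + t))
    (cos (2 * pi * (k%:~R * x) + t)).
  by rewrite mulrA; exact: is_derive_sin_affine.
have cF (x : R) : {for x, continuous (fun x => c^-1 * sin (c * x + t))}.
  by apply/differentiable_continuous/derivable1_diffP; case: (dF x).
rewrite (@continuous_FTC2 _ _ (fun x => c^-1 * sin (c * x + t)))//.
- by rewrite mulr1 mulr0 add0r sinD2pi_int mul0r -EFinB subrr.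
- apply: continuous_subspaceT => x.
  apply: continuous_comp; last exact: continuous_cos.
  apply: cvgD; last exact: cvg_cst.
  by do 2 (apply: cvgM; first exact: cvg_cst); exact: cvg_id.
- split; first by move=> x _; case: (dF x).
    by apply: cvg_at_right_filter; exact: cF.
  by apply: cvg_at_left_filter; exact: cF.
- by move=> x _; rewrite derive1E; case: (dF x).
Qed.

Lemma integrable_cos_comp d (T : measurableType d)
    (mu : {measure set T -> \bar R}) (D : set T) (phi : T -> R) :
  measurable D -> (mu D < +oo)%E ->
  measurable_fun D phi -> mu.-integrable D (fun x => (cos (phi x))%:E).
Proof.
move=> mD muD mphi.
apply: (@measurable_bounded_integrable _ _ _ mu (cos \o phi)) => //.
  exact: (measurableT_comp (continuous_measurable_fun (@continuous_cos R))).
exists 1; split; first exact: num_real.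
move=> M M1 x _; apply: le_trans (ltW M1).
by rewrite ler_norml cos_geN1 cos_le1.
Qed.

(** Induction on [n], with Fubini separating the first coordinate. For [x] fixed there, the rest is
    a wave in [n] variables whose shift is [2 * pi * k ord0 * x + t]; this is why the induction
    hypothesis must hold for every shift. *)
Lemma integral_wave n (k : 'I_n -> int) (t : R) :
  (\int[leb n]_(x in cube n) (wave k t x)%:E =
   ([forall i, k i == 0]%:R * cos t)%:E)%E.
Proof.
elim: n => [|n IH] in k t *.
  (* In dimension 0 the measure is the Dirac mass at the empty tuple and the phase is an empty
     sum. *)
  have -> : [forall i, k i == 0] by apply/forallP => -[].
  rewrite /= integral_dirac//.
  - rewrite diracE mem_set; last by case.
    by rewrite mul1e mul1r /wave /phase big_ord0 mulr0 add0r.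
  - exact: (@measurable_unit_cube R 0).
  - by apply/measurable_EFinP; apply: measurable_funTS; exact: measurable_wave.
have cubeS : @tuple_cons R n @^-1` cube n.+1 = `]0%R, 1%R[ `*` cube n.
  apply/seteqP; split => -[x y] /=.
    move=> h; split; first by have := h ord0; rewrite in_itv.
    by move=> i; have := h (lift ord0 i); rewrite tnthS.
  move=> [x01 h] i; have [j ->|->] := unliftP ord0 i.
    by rewrite tnthS; exact: h.
  by move: x01; rewrite in_itv.
have phaseS x (y : Rn n) : phase k (tuple_cons (x, y)) =
    (k ord0)%:~R * x + phase (fun i => k (lift ord0 i)) y.
  rewrite /phase big_ord_recl; congr (_ + _).
  by apply: eq_bigr => i _; rewrite tnthS.
have leb01 : @lebesgue_measure R `]0%R, 1%R[%classic = 1%E.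
  by rewrite lebesgue_measure_itv/= lte01 oppr0 adde0.
have mcube := @measurable_unit_cube R n.
have mS : measurable
    (`]0%R, 1%R[%classic `*` cube n : set (measurableTypeR R * Rn n)).
  by apply: measurableX => //; exact: measurable_itv.
have intS : (@lebesgue_measure R \x leb n)%E.-integrable
    (`]0%R, 1%R[ `*` cube n) (fun p => (wave k t (tuple_cons p))%:E).
  apply: integrable_cos_comp => //.
    have muS :
        ((@lebesgue_measure R \x leb n) (`]0%R, 1%R[ `*` cube n) < +oo)%E.
      rewrite product_measure1E//.
      by rewrite lebesgue_unit_cube mule1 [X in (X < _)%E]leb01 ltry.
    exact: muS.
  apply: measurable_funTS.
  apply: (measurableT_comp (measurable_phase k t)).
  exact: measurable_tuple_cons.
rewrite /= integral_pushforward//=; last 4 first.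
- exact: measurable_tuple_cons.
- by apply/measurable_EFinP; exact: measurable_wave.
- by rewrite cubeS.
- exact: measurable_unit_cube.
rewrite cubeS integral_mkcond -integral12_prod_meas1; last first.
  by apply/(integrable_mkcond _ mS); exact: intS.
(* The induction hypothesis evaluates the inner integral; what remains is a one-dimensional cosine
   integral. *)
transitivity (\int[lebesgue_measure]_(x in `]0%R, 1%R[)
    ([forall i, k (lift ord0 i) == 0]%:R%:E *
     (cos (2 * pi * ((k ord0)%:~R * x) + t))%:E))%E.
  rewrite [RHS]integral_mkcond; apply: eq_integral => x _.
  rewrite /fubini_F patchE; case: ifPn => x01.
    rewrite -EFinM addrC -IH [RHS]integral_mkcond; apply: eq_integral => y _.
    rewrite !patchE in_setX x01 /=; case: ifPn => // _; congr (cos _)%:E.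
    by rewrite phaseS; ring.
  by apply: integral0_eq => y _; rewrite patchE in_setX (negbTE x01).
rewrite integralZl//; last first.
  apply: integrable_cos_comp; first exact: measurable_itv.
    by rewrite [X in (X < _)%E]leb01 ltry.
  by apply: measurable_funD => //; do 2 apply: measurable_funM => //.
rewrite integral_cos_itv01 -EFinM mulrA -natrM mulnb.
congr ((nat_of_bool _)%:R * _)%:E.
apply/idP/idP => [/andP[/forallP k' k0]|/forallP k'].
  by apply/forallP => i; have [j ->|->] := unliftP ord0 i; [exact: k'|].
by apply/andP; split; [apply/forallP => i|]; exact: k'.
Qed.

(** * Inner products of waves and orthonormality *)

Lemma cube_measure_integralT n (f : Rn n -> \bar R) :
  (mu n).-integrable setT f ->
  (\int[mu n]_x f x = \int[mu n]_(x in cube n) f x)%E.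
Proof.
move=> intf; have mcube := @measurable_unit_cube R n.
rewrite (@negligible_integral _ _ _ _ _ (~` cube n)) ?setTD ?setCK//.
  exact: measurableC.
by rewrite /cube_measure /= /mfrestr /mrestr setICl measure0.
Qed.

Lemma integral_cube_measure n (f : Rn n -> \bar R) :
  (mu n).-integrable setT f ->
  (\int[mu n]_x f x = \int[leb n]_(x in cube n) f x)%E.
Proof.
move=> intf; rewrite cube_measure_integralT//.
apply: eq_measure_integral => A mA Acube.
by rewrite /cube_measure /= /mfrestr /mrestr setIidl.
Qed.

Lemma integrable_wave n (k : 'I_n -> int) t :
  (mu n).-integrable setT (EFin \o wave k t).
Proof.
apply: integrable_cos_comp => //; last exact: measurable_phase.
by rewrite -ge0_fin_numE// fin_num_measure.
Qed.

Lemma Rintegral_wave_mul n (k l : 'I_n -> int) (s t : R) :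
  \int[mu n]_x (wave k s x * wave l t x) =
  2^-1 * ([forall i, k i + l i == 0]%:R * cos (s + t) +
          [forall i, k i - l i == 0]%:R * cos (s - t)).
Proof.
have Iw (h : 'I_n -> int) r :
    \int[mu n]_x wave h r x = [forall i, h i == 0]%:R * cos r.
  rewrite /Rintegral integral_cube_measure; last exact: integrable_wave.
  by rewrite integral_wave.
under eq_Rintegral do rewrite wave_mul.
rewrite RintegralZl//; last first.
  exact: (integrableD measurableT (integrable_wave _ _) (integrable_wave _ _)).
by rewrite RintegralD ?Iw//; exact: integrable_wave.
Qed.

(** Every member of the system is a constant times a wave, so this one formula yields all the inner
    products. *)
Lemma L2_dot_wave n (f g : L2fun (mu n)) (a b s t : R) (k l : 'I_n -> int) :
  (forall x, f x = a * wave k s x) -> (forall x, g x = b * wave l t x) ->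
  L2_dot (L2_class f) (L2_class g) =
  a * b / 2 * ([forall i, k i + l i == 0]%:R * cos (s + t) +
               [forall i, k i - l i == 0]%:R * cos (s - t)).
Proof.
move=> fE gE; rewrite L2_dotE -mulrA -Rintegral_wave_mul -RintegralZl//.
  by apply: eq_Rintegral => x _; rewrite fE gE mulrACA.
apply: (eq_integrable measurableT
  (fun x => (wave k s x * wave l t x)%:E)) => //.
under eq_fun do rewrite wave_mul EFinM.
apply: integrableZl => //.
exact: (integrableD measurableT (integrable_wave _ _) (integrable_wave _ _)).
Qed.

(** At the smaller of the two leading positions one entry is positive and the other nonnegative.
    Hence the [k + l] term of the inner product always drops out. *)
Lemma lex_pos_add_neq0 n (k l : n.-tuple int) : lex_pos k -> lex_pos l ->
  [forall i, tnth k i + tnth l i == 0] = false.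
Proof.
wlog : k l / exists i, 0 < tnth k i /\ 0 <= tnth l i.
  move=> W kP lP; have [i [ki kj]] := kP; have [j [lj li]] := lP.
  have [ij|ji] := leqP i j; last first.
    under eq_forallb do rewrite addrC.
    by apply: W => //; exists j; rewrite kj.
  apply: W => //; exists i; split => //.
  by move: ij; rewrite leq_eqVlt => /orP[/eqP/val_inj ->|/li ->//]; exact: ltW.
move=> [i [ki li]] _ _; apply/forallP => /(_ i).
by rewrite gt_eqF// ltr_wpDr.
Qed.

Lemma forall_subr_eq0 n (k l : n.-tuple int) :
  [forall i, tnth k i - tnth l i == 0] = (k == l).
Proof.
apply/forallP/eqP => [kl|-> i]; last by rewrite subrr.
by apply/eq_from_tnth => i; apply/eqP; rewrite -subr_eq0.
Qed.

Lemma one_waveE n (x : Rn n) : 1 = 1 * wave (fun=> 0) 0 x.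
Proof.
rewrite /wave /phase big1 ?mulr0 ?addr0 ?cos0 ?mulr1// => i _.
by rewrite mul0r.
Qed.

Lemma cos_fun_waveE n k (x : Rn n) :
  cos_fun k x = Num.sqrt 2 * wave (tnth k) 0 x.
Proof. by rewrite /wave addr0. Qed.

Lemma sin_fun_waveE n k (x : Rn n) :
  sin_fun k x = Num.sqrt 2 * wave (tnth k) (- (pi / 2)) x.
Proof. by rewrite /wave cosBpihalf. Qed.

Lemma trig_system_orthonormal n u v : trig_system R n u -> trig_system R n v ->
  L2_dot u v = (u == v)%:R.
Proof.
(* Splitting on equality of classes settles the Kronecker delta without first showing that distinct
   indices give distinct classes. *)
have orth w z : L2_dot w w = 1 -> w = z \/ L2_dot w z = 0 ->
    L2_dot w z = (w == z)%:R.
  by move=> ww wz; have [<-//|/eqP neq] := eqVneq w z; case: wz.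
have s2 : Num.sqrt 2 * Num.sqrt 2 = 2 :> R by rewrite -expr2 sqr_sqrtr.
have w11 : L2_dot (one_L2 R n) (one_L2 R n) = 1.
  rewrite (@L2_dot_wave _ _ _ 1 1 0 0 (fun=> 0) (fun=> 0))//;
    try exact: one_waveE.
  have all0 (f : 'I_n -> int) : (forall i, f i = 0) ->
      [forall i, f i == 0] = true.
    by move=> f0; apply/forallP => i; rewrite f0.
  by rewrite !all0// addr0 subr0 cos0 /=; lra.
have wcc k l : lex_pos k -> lex_pos l ->
    L2_dot (@cos_L2 R n k) (cos_L2 R l) = (k == l)%:R.
  move=> kP lP; rewrite (@L2_dot_wave _ _ _ (Num.sqrt 2) (Num.sqrt 2)
      0 0 (tnth k) (tnth l));
    try exact: cos_fun_waveE.
  rewrite lex_pos_add_neq0// forall_subr_eq0 s2 subr0 cos0.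
  by rewrite mul0r add0r mulr1 divff ?mul1r.
have wss k l : lex_pos k -> lex_pos l ->
    L2_dot (@sin_L2 R n k) (sin_L2 R l) = (k == l)%:R.
  move=> kP lP; rewrite (@L2_dot_wave _ _ _ (Num.sqrt 2) (Num.sqrt 2)
      (- (pi / 2)) (- (pi / 2)) (tnth k) (tnth l));
    try exact: sin_fun_waveE.
  rewrite lex_pos_add_neq0// forall_subr_eq0 s2 subrr cos0.
  by rewrite mul0r add0r mulr1 divff ?mul1r.
(* For [k = l] the frequencies cancel, but the phases differ by a quarter period and
   [cos (pi / 2) = 0]. *)
have wcs k l : lex_pos k -> lex_pos l ->
    L2_dot (@cos_L2 R n k) (sin_L2 R l) = 0.
  move=> kP lP; rewrite (@L2_dot_wave _ _ _ (Num.sqrt 2) (Num.sqrt 2)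
      0 (- (pi / 2)) (tnth k) (tnth l));
    try exact: cos_fun_waveE; try exact: sin_fun_waveE.
  rewrite lex_pos_add_neq0// !sub0r opprK cos_pihalf.
  by rewrite mulr0 mul0r addr0 mulr0.
(* A general shift [t] treats cosines and sines together: the positive entry of [l] makes both
   frequencies [l] and [- l] nonzero. *)
have w1 (l : n.-tuple int) (g : L2fun (mu n)) t : lex_pos l ->
    (forall x, g x = Num.sqrt 2 * wave (tnth l) t x) ->
    L2_dot (one_L2 R n) (L2_class g) = 0.
  move=> lP gE.
  rewrite (@L2_dot_wave _ _ _ 1 (Num.sqrt 2) 0 t (fun=> 0) (tnth l))//;
    try exact: one_waveE.
  have [i [li _]] := lP.
  have not0 (f : 'I_n -> int) : f i != 0 -> [forall i, f i == 0] = false.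
    by move=> fi; apply/forallP => /(_ i); rewrite (negbTE fi).
  rewrite !not0 ?sub0r ?oppr_eq0 ?add0r ?gt_eqF//.
  by rewrite !mul0r addr0 mulr0.
have w1c l : lex_pos l -> L2_dot (one_L2 R n) (cos_L2 R l) = 0.
  by move=> lP; apply: (w1 l _ 0) => // x; exact: cos_fun_waveE.
have w1s l : lex_pos l -> L2_dot (one_L2 R n) (sin_L2 R l) = 0.
  by move=> lP; apply: (w1 l _ (- (pi / 2))) => // x; exact: sin_fun_waveE.
move=> [[->|[k kP <-]]|[k kP <-]] [[->|[l lP <-]]|[l lP <-]]; apply: orth.
all: rewrite ?w11 ?wcc ?wss ?eqxx//; try by left.
all: try by right; rewrite ?w1c ?w1s ?wcs// L2_dotC ?w1c ?w1s ?wcs.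
all: by have [->|_] := eqVneq k l; [left|right].
Qed.

(** * Density: waves are approximable *)

(** The sign of the first nonzero entry decides. *)
Lemma lex_pos_trichotomy n (k : n.-tuple int) :
  [\/ forall i, tnth k i = 0, lex_pos k | lex_pos [tuple - tnth k i | i < n]].
Proof.
have [k0|] := pselect (forall i, tnth k i = 0); first exact: Or31.
move/existsNP => [i0 /eqP ki0].
case: (@arg_minnP _ i0 (fun i => tnth k i != 0) val) => // i ki imin.
have before (j : 'I_n) : (j < i)%N -> tnth k j = 0.
  by move=> ji; apply: contraTeq ji => /imin; rewrite leqNgt.
have [kpos|kneg|k0] := ltgtP 0 (tnth k i).
- by apply: Or32; exists i.
- apply: Or33; exists i; rewrite tnth_mktuple oppr_gt0; split => // j.
  by move=> /before kj; rewrite tnth_mktuple kj oppr0.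
- by rewrite -k0 eqxx in ki.
Qed.

Notation approx n := (L2_approx (trig_system R n) (cube n)).

Lemma L2_approx_gen n (p : L2fun (mu n)) :
  trig_system R n (L2_class p) -> approx n p.
Proof.
move=> Bp e e0; exists p; first exact: lin_span_gen.
rewrite /sqr_dist; under eq_integral do rewrite subrr expr0n.
by rewrite integral0 lte_fin.
Qed.

(** For a positive frequency, the addition formula writes the wave as a combination of [cos_fun] and
    [sin_fun]. A negative one is reversed by evenness of the cosine, which also flips the shift, and
    frequency 0 gives a constant. *)
Lemma L2_approx_wave n (k : 'I_n -> int) t : approx n (wave k t).
Proof.
have mcube := @measurable_unit_cube R n.
have mc k' : measurable_fun (cube n) (@cos_fun R n k').
exact: (measurable_L2fun (Lfun_Sub (lee1n 2) (cos_fun_Lfun R k'))).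
have ms k' : measurable_fun (cube n) (@sin_fun R n k').
  exact: (measurable_L2fun (Lfun_Sub (lee1n 2) (sin_fun_Lfun R k'))).
have pos (k' : n.-tuple int) s : lex_pos k' -> approx n (wave (tnth k') s).
  move=> k'P; pose r := Num.sqrt 2 : R.
  have r0 : r != 0 by rewrite gt_eqF// sqrtr_gt0.
  have -> : wave (tnth k') s = (fun x => cos s / r * cos_fun k' x) \+
      (fun x => - sin s / r * sin_fun k' x).
    apply/funext => x /=; rewrite /wave cosD /cos_fun /sin_fun -/r.
    by rewrite -[phase (tnth k') x]/(scalar_prod k' x); field.
  apply: L2_approxD => //.
  - exact: measurable_funM.
  - exact: measurable_funM.
  - apply: L2_approxZ => //.
    apply: (@L2_approx_gen _ (Lfun_Sub _ (cos_fun_Lfun R k'))).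
    by left; right; exists k'.
  - apply: L2_approxZ => //.
    apply: (@L2_approx_gen _ (Lfun_Sub _ (sin_fun_Lfun R k'))).
    by right; exists k'.
pose k' := [tuple k i | i < n].
have kE : k = tnth k' by apply/funext => i; rewrite tnth_mktuple.
have [k0|k'P|k'P] := lex_pos_trichotomy k'.
- have -> : wave k t = fun x => cos t * cst 1 x.
    apply/funext => x; rewrite /wave /phase big1 ?mulr0 ?add0r ?mulr1// => i _.
    by rewrite kE k0 mul0r.
  apply: L2_approxZ => //.
  by apply: (@L2_approx_gen _ (Lfun_Sub _ (Lfun_cst (mu n) 1 2))); left; left.
- by rewrite kE; exact: pos.
- have -> : wave k t = wave (tnth [tuple - tnth k' i | i < n]) (- t).
    apply/funext => x; rewrite /wave -cosN opprD -mulrN -sumrN.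
    congr (cos (_ * _ + _)).
    by apply: eq_bigr => i _; rewrite !tnth_mktuple mulrNz mulNr.
  exact: pos.
Qed.

(** * Density: from waves to indicators, simple functions and all of L2 *)

Notation waves n := [set f | exists k t, f = @wave n k t].
Notation bl n := (bounded_limits (cube n) (waves n)).

Lemma bl_wave n (k : 'I_n -> int) t : bl n (wave k t).
Proof. by apply: bl_gen; exists k, t. Qed.

(** Measurability is carried through the induction because each approximation lemma requires it. In
    the limit case the bound [C] serves as dominating function, its square being integrable for a
    finite measure. *)
Lemma bl_measurable_approx n f :
  bl n f -> measurable_fun (cube n) f /\ approx n f.
Proof.
have mcube := @measurable_unit_cube R n.
elim=> {f} [_ [k [t ->]]|f g _ [mf af] _ [mg ag]|a f _ [mf af]|].
- split; last exact: L2_approx_wave.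
  by apply: measurable_funTS; exact: measurable_wave.
- by split; [exact: measurable_funD|exact: L2_approxD].
- by split; [exact: measurable_funM|exact: L2_approxZ].
move=> f_ f C _ IH fC ff; have mf : measurable_fun (cube n) f.
  by apply: measurable_fun_cvg ff => m; case: (IH m).
split => //.
apply: (@L2_approx_lim _ _ _ _ _ _ mcube f_ f (cst C)) => //.
- by move=> m; case: (IH m).
- apply: (integrableS measurableT mcube (@subsetT _ _)).
  exact: (finite_measure_integrable_cst (mu n) (C ^+ 2)).
- by move=> m; case: (IH m).
Qed.

Lemma bl_one n : bl n (cst 1).
Proof.
rewrite (_ : cst 1 = @wave n (fun=> 0) 0); first exact: bl_wave.
by apply/funext => x; rewrite [LHS](one_waveE x) mul1r.
Qed.

Lemma bl_wave_mul n f g : waves n f ->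
  waves n g -> bl n (f \* g).
Proof.
move=> [k [s ->]] [l [t ->]].
rewrite (_ : _ \* _ = fun x => 2^-1 * (wave (fun i => k i + l i) (s + t) \+
                              wave (fun i => k i - l i) (s - t)) x).
  by apply: bl_scale; apply: bl_add; exact: bl_wave.
by apply/funext => x; rewrite /= wave_mul.
Qed.

Lemma bl_wave_bounded n f : waves n f ->
  exists C, forall x, cube n x -> `|f x| <= C.
Proof. by move=> [k [t ->]]; exists 1 => x _; exact: wave_bounded. Qed.

Lemma bl_indic_gt n (i : 'I_n) (c : R) : bl n \1_[set x | c < tnth x i].
Proof.
have [[G1 GM] GB] := (@bl_one n, @bl_wave_mul n, @bl_wave_bounded n).
(* For [c] outside [[0, 1]] the indicator is constant on the cube. Otherwise [|y - c| < 1] for every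
   coordinate [y] of a point of the cube, so [sin (pi * (y - c))] has the sign of [y - c]. *)
have [c0|c0] := ltP c 0.
  apply: (bl_eq GB) G1 => x /(_ i)/andP[x0 _].
  by rewrite indicE mem_set//=; exact: lt_trans x0.
have [c1|c1] := ltP 1 c.
  apply: (bl_eq GB) (bl_cst G1 0) => x /(_ i)/andP[_ x1].
  by rewrite indicE memNset//= => /(lt_trans c1)/lt_trans/(_ x1); rewrite ltxx.
pose k := fun j : 'I_n => (j == i)%:Z.
have phase_k x : phase k x = tnth x i.
  rewrite /phase (bigD1 i)//= /k eqxx mul1r big1 ?addr0// => j /negbTE ->.
  by rewrite mul0r.
have := bl_indic_gt0 G1 GM GB
  (bl_add (bl_cst G1 (cos (pi * c))) (bl_scale (-1) (bl_wave k (- (pi * c))))).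
apply: (bl_eq GB) => x /(_ i)/andP[]; set y : R := tnth x i => y0 y1.
(* Sum-to-product: the factor [sin (pi * y)] is positive on the cube, so the other sine alone
   decides the sign. *)
have fE : cos (pi * c) + -1 * wave k (- (pi * c)) x =
    2 * sin (pi * y) * sin (pi * (y - c)).
  rewrite /wave phase_k -/y.
  have -> : pi * c = pi * y - pi * (y - c) by ring.
  have -> : 2 * pi * y - (pi * y - pi * (y - c)) = pi * y + pi * (y - c).
    by ring.
  by rewrite cosB cosD; ring.
have piy : 0 < pi * y < pi by rewrite mulr_gt0 ?pi_gt0//= gtr_pMr ?pi_gt0.
have sy : 0 < 2 * sin (pi * y) by rewrite mulr_gt0// sin_gt0_pi.
rewrite !indicE; congr (nat_of_bool _)%:R.
apply/idP/idP; rewrite !inE/= -/y fE pmulr_rgt0//.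
- apply: contraTT; rewrite -!leNgt => yc.
  rewrite -oppr_ge0 -sinN sin_ge0_pi//.
  by have := pi_gt0 R; nra.
- by move=> cy; apply: sin_gt0_pi; have := pi_gt0 R; nra.
Qed.

(** Two generation arguments: the sigma-algebra on tuples is generated by preimages under
    coordinates, and that of the line by the rays []c, +oo[], whose preimages are the half-spaces of
    [bl_indic_gt]. *)
Lemma bl_indic_measurable n (A : set (Rn n)) : measurable A -> bl n \1_A.
Proof.
have sG :=
  bl_indic_sigma_algebra (@bl_one n) (@bl_wave_mul n) (@bl_wave_bounded n).
move=> mA; apply: (smallest_sub sG _ mA) => {mA} {}A.
(* In dimension 0 the generating family is empty; otherwise [inord] can name the coordinate. *)
case: n => [|n] in A sG *; first by rewrite big_ord0.
rewrite -bigcup_mkord_ord => -[j jn [B mB <-]]; rewrite setTI.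
set i := inord j.
have : (@RGenOInfty.G R).-sigma.-measurable B.
  by rewrite -RGenOInfty.measurableE.
apply: (@smallest_sub _ _ _
  [set B | bl n.+1 \1_((fun x : Rn n.+1 => tnth x i) @^-1` B)]).
  have [S0 SC SU] := sG; split=> [|B' blB|F blF] /=.
  - exact: S0.
  - by have := SC _ blB; rewrite !setTD.
  - by rewrite preimage_bigcup; exact: SU.
move=> _ [c ->] /=; have := bl_indic_gt i c; congr (bl _ \1_ _).
by apply/seteqP; split => x /=; rewrite in_itv/= andbT.
Qed.

Import HBSimple.
Import HBNNSimple.

Lemma bl_sfun n (f : {sfun Rn n >-> R}) : bl n f.
Proof.
have [[G1 GM] GB] := (@bl_one n, @bl_wave_mul n, @bl_wave_bounded n).
rewrite (_ : f = (fun x => \sum_(y <- finmap.enum_fset (fset_set (range f)))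
    y * \1_(f @^-1` [set y]) x) :> (_ -> _)).
  by apply: bl_sum => // y; apply: bl_scale; exact: bl_indic_measurable.
by apply/funext => x; rewrite fimfunE fsbig_finite.
Qed.

(** [f] is the limit of simple functions lying below it. These need not be uniformly bounded, so the
    limit is taken by [L2_approx_lim] with the square-integrable bound [g]. *)
Lemma L2_approx_nonneg n (f g : Rn n -> R) : measurable_fun setT f ->
  (forall x, 0 <= f x <= g x) ->
  (mu n).-integrable (cube n) (fun x => (g x ^+ 2)%:E) -> approx n f.
Proof.
move=> mf fg ig; have mcube := @measurable_unit_cube R n.
have f0 x : cube n x -> (0 <= (EFin \o f) x)%E.
  by move=> _; rewrite lee_fin; case/andP: (fg x).
have mf' : measurable_fun (cube n) (EFin \o f).
  by apply/measurable_EFinP; exact: measurable_funTS.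
apply: (@L2_approx_lim _ _ _ _ _ _ mcube
  (fun m x => nnsfun_approx mcube mf' m x) f g) => //.
- by move=> m; apply: measurable_funTS.
- exact: measurable_funTS.
- move=> m x Dx; rewrite ger0_norm//; have /andP[_] := fg x; apply: le_trans.
  by rewrite -lee_fin nnsfun_approxE le_approx.
- move=> x Dx; have := cvg_nnsfun_approx mcube mf' f0 Dx.
  by move=> /fine_cvgP[_]; exact: cvg_trans.
- move=> m.
  by case: (bl_measurable_approx (bl_sfun (nnsfun_approx mcube mf' m))).
Qed.

Lemma trig_system_dense n (v : L2 (mu n)) (e : R) : 0 < e ->
  exists2 w, lin_span (trig_system R n) w &
    Num.sqrt (L2_dot (v - w) (v - w)) < e.
Proof.
move=> e0; elim/L2_ind: v => f; have mcube := @measurable_unit_cube R n.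
have mf : measurable_fun setT f by exact: measurable_funPT.
have iff : (mu n).-integrable (cube n) (fun x => (`|f x| ^+ 2)%:E).
  have := integrable_L2fun_mul f f.
  move=> /(integrableS measurableT mcube (@subsetT _ _)).
  by apply: eq_integrable => // x _; rewrite real_normK ?num_real.
have af : approx n f.
  (* Both parts are nonnegative and bounded by [|f|], whose square is integrable. *)
  have -> : (f : _ -> R) = f^\+ \+ (fun x => -1 * f^\- x).
    by rewrite -[LHS]funrposBneg; apply/funext => x; rewrite /= mulN1r.
  apply: L2_approxD => //.
  - by apply: measurable_funTS; exact: measurable_funrpos.
  - apply: measurable_funM => //.
    by apply: measurable_funTS; exact: measurable_funrneg.
  - apply: L2_approx_nonneg iff; first exact: measurable_funrpos.
    by move=> x; rewrite funrpos_ge0 /funrpos ge_max normr_ge0 ler_norm.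
  - apply: L2_approxZ => //.
      by apply: measurable_funTS; exact: measurable_funrneg.
    apply: L2_approx_nonneg iff; first exact: measurable_funrneg.
    by move=> x; rewrite funrneg_ge0 /funrneg ge_max normr_ge0 -normrN ler_norm.
(* The tolerance is [e ^+ 2] because [sqr_dist] is the square of the norm. *)
have [p Bp fp] := af _ (exprn_gt0 2 e0).
exists (L2_class p) => //.
rewrite -linearB L2_dotE -ltr_sqr ?nnegrE ?sqrtr_ge0 ?ltW//.
rewrite sqr_sqrtr; last first.
  by apply: Rintegral_ge0 => x _; rewrite -expr2 sqr_ge0.
rewrite /Rintegral cube_measure_integralT; last exact: integrable_L2fun_mul.
have fin : sqr_dist (mu n) (cube n) f p \is a fin_num.
  rewrite ge0_fin_numE; first exact: lt_trans fp (ltry _).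
  by apply: integral_ge0 => x _; rewrite lee_fin sqr_ge0.
by rewrite -lte_fin fineK.
Qed.

End trigonometric_system.

Theorem theorem3p7 (R : realType) (n : nat) (hn : (1 <= n)%N) :
  orthonormal_basis (L2_dot (mu := cube_measure R n)) (trig_system R n).
Proof.
by split; [exact: trig_system_orthonormal|exact: trig_system_dense].
Qed.
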